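(* Let $A,B$ be finite subsets of the positive integers, let $(a_i)_{i\in A}$, $(b_i)_{i\in B}$ be real numbers, and let $i\in\{1,2\}$. Let $\mathcal{S}_i$, with weight function $w$ and length function $l$, be the step set of Class $i$ defined in the context. For integers $0\le m\le n$, let $\bar g_{i;n,m}$ be the sum of the weights $w(L)$ over all pointed $(\mathcal{S}_i,1)$-lattice paths $\dot L$ which (a) have length $l(L)=n+1$; (b) have absolute minimum pointed length $mlp(\dot L)=m$; (c) have final step of length at least $1$. Let $f_{i;n}$ be the sum of the weights of all $\mathcal{S}_i$-nonnegative paths of length $n$. Then for all integers $0\le m\le n$, $$\bar g_{i;n,m}=f_{i;n}.$$
   Context: Lattice paths. For a step set $\mathcal{S}\subset\mathbb{Z}\times\mathbb{Z}\setminus\{(0,0)\}$ and an integer $k$, an $(\mathcal{S},k)$-lattice path is a finite sequence $L=s_1s_2\cdots s_m$ ($m\ge 0$) of steps in $\mathcal{S}$, starting at $(0,0)=(x_0,y_0)$, with successive points $(x_j,y_j)=(x_{j-1},y_{j-1})+s_j$, and ending on the line $y=k$ (so $y_m=k$). Given a weight function $w:\mathcal{S}\to\mathbb{R}$ and a length function $l:\mathcal{S}\to\mathbb{R}$, put $w(L)=\prod_{j=1}^m w(s_j)$ and $l(L)=\sum_{j=1}^m l(s_j)$ (the empty path has weight $1$ and length $0$). An $\mathcal{S}$-nonnegative path is an $(\mathcal{S},0)$-lattice path that never goes below the line $y=0$ (the empty path is included). Absolute minimum length. A minimum point of $L$ is a point $(x_r,y_r)$, $0\le r\le m$, with $y_r\le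 y_j$ for all $0\le j\le m$. The absolute minimum point is the rightmost minimum point (largest index $r$), and its index is the absolute minimum position $mp(L)$. The absolute minimum length is $ml(L)=\sum_{1\le j\le mp(L)} l(s_j)$. Step sets ($A,B$ are finite sets of positive integers, $a_i,b_i$ real): Class 1: $\mathcal{S}_1=\{(2i-1,-1): i\in A\}\cup\{(2i,0): i\in B\}\cup\{(1,1)\}$, with $l((2i,0))=i$, $l((2i-1,-1))=i-1$, $l((1,1))=1$; $w((2i,0))=b_i$, $w((2i-1,-1))=a_i$, $w((1,1))=1$. Class 2: $\mathcal{S}_2=\{(i,-1): i\in A\}\cup\{(i,0): i\in B\}\cup\{(1,1)\}$, with $l((i,0))=i$, $l((i,-1))=i$, $l((1,1))=1$; $w((i,0))=b_i$, $w((i,-1))=a_i$, $w((1,1))=1$. Pointed paths. Let $L=s_1\cdots s_m$ be a nonempty $(\mathcal{S}_i,k)$-lattice path whose final step satisfies $l(s_m)\ge 1$. A pointed $(\mathcal{S}_i,k)$-lattice path with underlying path $L$ is $\dot L=[L,(x_m-2j,0)]$ for Class 1, and $\dot L=[L,(x_m-j,0)]$ for Class 2, for some integer $0\le j\le l(s_m)-1$; that is, $L$ together with a marked point on the $x$-axis (equivalently, with the choice of $j$). Its pointed length is $p(\dot L)=j$, and its length and weight are those of $L$. The absolute minimum pointed length is $mlp(\dot L)=ml(L)+p(\dot L)$. *)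

(* Defs.v *)
From mathcomp Require Import all_boot all_order all_algebra finmap.
From mathcomp Require Import boolp classical_sets cardinality fsbigop reals.
From mathcomp Require Import lra.

Set Implicit Arguments.
Unset Strict Implicit.
Unset Printing Implicit Defensive.

Import Order.TTheory GRing.Theory Num.Theory.
Local Open Scope classical_set_scope.
Local Open Scope ring_scope.

(* (dx, dy); pairs add componentwise, so a point of Z x Z has the same type. *)
Definition step := (int * int)%type.

Section Paths.
Variable R : realType.
Implicit Types (S : {fset step}) (w l : step -> R) (k : int) (L : seq step).

(* (x_j, y_j); meaningful for j <= size L. *)
Definition point L (j : nat) : int * int := \sum_(s <- take j L) s.

Definition is_path S k L : Prop :=
  (forall s, s \in L -> s \in S) /\ (point L (size L)).2 = k.

Definition path_weight w L : R := \prod_(s <- L) w s.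

Definition path_length l L : R := \sum_(s <- L) l s.

Definition is_nonneg_path S L : Prop :=
  is_path S 0 L /\ forall j : nat, (j <= size L)%N -> 0 <= (point L j).2.

Definition is_min_point L (r : nat) : bool :=
  (r <= size L)%N && [forall j : 'I_(size L).+1, (point L r).2 <= (point L j).2].

Definition mp L : nat := (\max_(r < (size L).+1 | is_min_point L r) r)%N.

Definition ml l L : R := path_length l (take (mp L) L).

Definition last_step L : step := last (0, 0) L.

(* A pointed path [L, (x_m - 2j, 0)] (resp. [L, (x_m - j, 0)]) is encoded by
   the pair (L, j): for a given L, the marked point and j determine each
   other, and j is its pointed length. *)
Definition pointed_path := (seq step * nat)%type.

Definition is_pointed_path S l k (P : pointed_path) : Prop :=
  [/\ P.1 != [::], is_path S k P.1, 1 <= l (last_step P.1)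
    & P.2%:R <= l (last_step P.1) - 1].

Definition pointed_length (P : pointed_path) : nat := P.2.

Definition mlp l (P : pointed_path) : R := ml l P.1 + (pointed_length P)%:R.

(* The two sums below range over sets of paths that are finite for the step
   sets of interest (see [finite_nonneg_set] and [finite_pointed_set]). *)
Definition nonneg_set S l (n : nat) : set (seq step) :=
  [set L | is_nonneg_path S L /\ path_length l L = n%:R].

Definition f_sum S w l (n : nat) : R :=
  \sum_(L \in nonneg_set S l n) path_weight w L.

Definition pointed_set S l (n m : nat) : set pointed_path :=
  [set P | is_pointed_path S l 1 P /\
           [/\ path_length l P.1 = n.+1%:R,
               mlp l P = m%:R
             & 1 <= l (last_step P.1)]].

Definition gbar_sum S w l (n m : nat) : R :=
  \sum_(P \in pointed_set S l n m) path_weight w P.1.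

End Paths.

Inductive step_class := Class1 | Class2.

Definition up_step : step := (1, 1).

Definition level_step (c : step_class) (i : nat) : step :=
  match c with Class1 => ((2 * i)%N%:Z, 0) | Class2 => (i%:Z, 0) end.

Definition down_step (c : step_class) (i : nat) : step :=
  match c with Class1 => ((2 * i)%N%:Z - 1, -1) | Class2 => (i%:Z, -1) end.

Definition steps (c : step_class) (A B : {fset nat}) : {fset step} :=
  ([fset down_step c i | i in A] `|` [fset level_step c i | i in B]
    `|` [fset up_step])%fset.

(* The index i of a level or down step, read off its horizontal displacement
   (2i or 2i-1 in class 1, i in class 2). *)
Definition step_index (c : step_class) (s : step) : nat :=
  match c with Class1 => uphalf `|s.1|%N | Class2 => `|s.1|%N end.

Section Classes.
Variable R : realType.
Implicit Types (c : step_class) (A B : {fset nat}) (a b : nat -> R) (s : step).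

Definition step_weight c a b s : R :=
  if s.2 == 1 then 1
  else if s.2 == 0 then b (step_index c s) else a (step_index c s).

Definition step_length c s : R :=
  if s.2 == 1 then 1
  else if s.2 == 0 then (step_index c s)%:R
  else match c with
       | Class1 => (step_index c s)%:R - 1
       | Class2 => (step_index c s)%:R
       end.

Lemma step_index_level c i : step_index c (level_step c i) = i.
Proof. by case: c => //=; rewrite mul2n uphalf_double. Qed.

Lemma step_index_down c i : (0 < i)%N -> step_index c (down_step c i) = i.
Proof.
case: i => // i _; case: c => //; rewrite /step_index /down_step /fst.
by rewrite mul2n doubleS -(addn1 i.*2.+1) PoszD addrK absz_nat /= doubleK.
Qed.

Lemma step_weight_up c a b : step_weight c a b up_step = 1.
Proof. by []. Qed.

Lemma step_weight_level c a b i : step_weight c a b (level_step c i) = b i.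
Proof.
by rewrite -[in RHS](step_index_level c i) /step_weight; case: c.
Qed.

Lemma step_weight_down c a b i : (0 < i)%N ->
  step_weight c a b (down_step c i) = a i.
Proof.
by move=> /(step_index_down c) {2}<-; rewrite /step_weight; case: c.
Qed.

Lemma step_length_up c : step_length c up_step = 1.
Proof. by []. Qed.

Lemma step_length_level c i : step_length c (level_step c i) = i%:R.
Proof.
by rewrite -[in RHS](step_index_level c i) /step_length; case: c.
Qed.

Lemma step_length_down1 i : (0 < i)%N ->
  step_length Class1 (down_step Class1 i) = i%:R - 1.
Proof. by move=> /(step_index_down Class1) {2}<-. Qed.

Lemma step_length_down2 i : step_length Class2 (down_step Class2 i) = i%:R.
Proof. by []. Qed.

Lemma step_length_bounds c A B s :
  (forall i, i \in A -> (0 < i)%N) -> (forall i, i \in B -> (0 < i)%N) ->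
  s \in steps c A B ->
  0 <= step_length c s /\ 1 <= 2 * step_length c s - s.2%:~R.
Proof.
move=> A0 B0; rewrite !in_fsetE => /orP[/orP[]|].
- move=> /imfsetP[i /= /A0 i0 ->].
  have ge1 : 1 <= i%:R :> R by rewrite ler1n.
  have e2 : (down_step c i).2%:~R = -1 :> R by case: c; rewrite /= mulrN1z.
  rewrite e2; case: c {e2}; rewrite ?step_length_down1 ?step_length_down2 //;
    split; lra.
- move=> /imfsetP[i /= /B0 i0 ->].
  have ge1 : 1 <= i%:R :> R by rewrite ler1n.
  have e2 : (level_step c i).2%:~R = 0 :> R by case: c.
  by rewrite e2 step_length_level; split; lra.
- by move=> /eqP ->; rewrite step_length_up /=; split; lra.
Qed.

Lemma path_size_le c A B k L :
  (forall i, i \in A -> (0 < i)%N) -> (forall i, i \in B -> (0 < i)%N) ->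
  is_path (steps c A B) k L ->
  (size L)%:R <= 2 * path_length (@step_length c) L - k%:~R.
Proof.
move=> A0 B0 [SL <-]; rewrite /point take_size /path_length.
elim: L SL => [_|s L IH SL]; first by rewrite !big_nil /=; lra.
have /IH {}IH t : t \in L -> t \in steps c A B.
  by move=> tL; apply: SL; rewrite inE tL orbT.
have [_ s1] := step_length_bounds A0 B0 (SL s (mem_head _ _)).
rewrite !big_cons /= intrD -natr1.
by move: IH s1; set u := size L; set v := bigop _ _ _; set x := bigop _ _ _; lra.
Qed.

Lemma finite_seq_le (T : choiceType) (S : {fset T}) (N : nat) :
  finite_set [set L : seq T | (forall x, x \in L -> x \in S) /\ (size L <= N)%N].
Proof.
elim: N => [|N IH].
  apply: (sub_finite_set _ (finite_set1 [::])) => L [_ /=].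
  by rewrite leqn0 size_eq0 => /eqP.
pose h (p : T * seq T) := p.1 :: p.2.
have fX := finite_image h (finite_setX (finite_fset S) IH).
have fU : finite_set ([set [::]] `|` h @` ([set` S] `*`
    [set L | (forall x, x \in L -> x \in S) /\ (size L <= N)%N])).
  by rewrite finite_setU; split=> //; exact: finite_set1.
apply: (sub_finite_set _ fU) => -[|x L] /= [SL szL]; first by left.
right; exists (x, L) => //; split; first by apply: SL; rewrite mem_head.
by split=> // t tL; apply: SL; rewrite inE tL orbT.
Qed.

Lemma finite_path_set c A B k n :
  (forall i, i \in A -> (0 < i)%N) -> (forall i, i \in B -> (0 < i)%N) ->
  finite_set [set L | is_path (steps c A B) k L /\
                      path_length (@step_length c) L = n%:R].
Proof.
move=> A0 B0; apply: (sub_finite_set _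
  (finite_seq_le (steps c A B) (2 * n + `|k|)%N)) => L [pL lL].
split; first by case: pL.
have := path_size_le A0 B0 pL; rewrite lL -(ler_nat R) natrD natrM.
move/le_trans; apply; rewrite lerD2l.
by rewrite -(intrN _ k) -[X in _ <= X]/(`|k|%N%:Z%:~R) ler_int abszE -normrN ler_norm.
Qed.

Lemma finite_nonneg_set c A B n :
  (forall i, i \in A -> (0 < i)%N) -> (forall i, i \in B -> (0 < i)%N) ->
  finite_set (nonneg_set (steps c A B) (@step_length c) n).
Proof.
move=> A0 B0; apply: sub_finite_set (finite_path_set c 0 n A0 B0).
by move=> L [[pL _] lL].
Qed.

Lemma finite_pointed_set c A B n m :
  (forall i, i \in A -> (0 < i)%N) -> (forall i, i \in B -> (0 < i)%N) ->
  finite_set (pointed_set (steps c A B) (@step_length c) n m).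
Proof.
move=> A0 B0.
have fX := finite_setX (finite_path_set c 1 n.+1 A0 B0) (finite_II m.+1).
apply: (sub_finite_set _ fX) => -[L j] [[/= _ pL _ _] [lL mL _]].
split=> //=; rewrite ltnS -(ler_nat R) -mL /mlp /= lerDr.
rewrite /ml /path_length big_seq; apply: sumr_ge0 => s /mem_take sL.
by have [] := step_length_bounds A0 B0 (pL.1 s sL).
Qed.

End Classes.

(* Main.v *)
Require Import Defs.
From mathcomp Require Import all_boot all_order all_algebra finmap.
From mathcomp Require Import boolp classical_sets functions cardinality fsbigop reals.
From mathcomp Require Import zify lra.

(** The proof is a cycle lemma.  Cut a path [L] that ends at height 1 at its
    rightmost minimum, [L = L1 ++ L2], and swap the two factors: in
    [W = L2 ++ L1] every nonempty prefix ends strictly above the axis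
    ([rot_mp_positive]).  Since the up step is the only one that climbs,
    and it climbs by 1, [W] is an up step followed by a path [N] that never
    goes below its starting level and returns to it: a nonnegative path, of the
    same weight as [L] and one unit shorter.

    The word [W] is shared by all its cuts [W = take r W ++ drop r W], [0 < r],
    and the path [drop r W ++ take r W] has its rightmost minimum precisely at
    the seam ([mp_cat]).  Its absolute minimum length is therefore the length of
    [drop r W], while its last step is the [r]-th step of [W].  As the pointed
    length [j] runs over the natural numbers below the length of that step, the
    absolute minimum pointed length runs over the integers of the half-open
    interval from the length of [drop r W] to the length of [drop r.-1 W].
    These intervals tile the one from 0 to the length [n + 1] of [W], so that
    each [m <= n] is obtained from exactly one pair [(r, j)].  Hence, for fixed
    [m], sending [(L, j)] to [N] is a weight-preserving bijection; uniqueness of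
    [r] is [cut_unique], its existence [cut_exists].

    All this only uses that steps have natural lengths and climb by at most 1,
    and that the up step is the only climbing one and has weight and length 1. *)

Set Implicit Arguments.
Unset Strict Implicit.
Unset Printing Implicit Defensive.

Import Order.TTheory GRing.Theory Num.Theory.
Local Open Scope classical_set_scope.
Local Open Scope ring_scope.

(** * Heights and the rightmost minimum *)

Section Height.
Implicit Types (L W : seq step) (k : int).

Definition height L : int := \sum_(s <- L) s.2.

Lemma height_cat L1 L2 : height (L1 ++ L2) = height L1 + height L2.
Proof. exact: big_cat. Qed.

Lemma height_cons s L : height (s :: L) = s.2 + height L.
Proof. exact: big_cons. Qed.

Lemma point_height L j : (Defs.point L j).2 = height (take j L).
Proof.
rewrite /Defs.point /height; elim: (take j L) => [|s K IH]; first by rewrite !big_nil.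
by rewrite !big_cons /= IH.
Qed.

Lemma is_pathE (S : {fset step}) k L :
  is_path S k L <-> {subset L <= S} /\ height L = k.
Proof. by rewrite /is_path point_height take_size. Qed.

Lemma is_min_pointP L r :
  reflect ((r <= size L)%N /\
           forall j, (j <= size L)%N -> height (take r L) <= height (take j L))
          (is_min_point L r).
Proof.
apply: (iffP andP) => -[rL H]; split=> //.
  move=> j jL; have /forallP/(_ (Ordinal (jL : (j < (size L).+1)%N))) := H.
  by rewrite !point_height.
by apply/forallP => j; rewrite !point_height H // -ltnS.
Qed.

Lemma is_min_point_mp L : is_min_point L (mp L).
Proof.
pose P := [pred r : 'I_(size L).+1 | is_min_point L r].
have P0 : (0 < #|P|)%N.
  have [r _ rmin] := @arg_minP _ _ _ ord0 predT
    (fun i : 'I_(size L).+1 => height (take i L)) isT.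
  apply/card_gt0P; exists r; apply/is_min_pointP; split; first by rewrite -ltnS.
  by move=> j; rewrite -ltnS => jL; exact: (rmin (Ordinal jL) isT).
have [r rP mpr] := @eq_bigmax_cond _ P (fun r => nat_of_ord r) P0.
by rewrite /mp mpr.
Qed.

Lemma mp_max L r : is_min_point L r -> (r <= mp L)%N.
Proof.
move=> /[dup] rP /is_min_pointP[rL _].
exact: (@leq_bigmax_cond _ (fun r : 'I_(size L).+1 => is_min_point L r)
  (fun r => nat_of_ord r) (Ordinal (rL : (r < (size L).+1)%N)) rP).
Qed.

Lemma mp_le_size L : (mp L <= size L)%N.
Proof. by have /is_min_pointP[] := is_min_point_mp L. Qed.

Lemma height_take_mp L j :
  (j <= size L)%N -> height (take (mp L) L) <= height (take j L).
Proof. by have /is_min_pointP[_] := is_min_point_mp L; apply. Qed.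

Lemma height_take_mp_lt L j : (mp L < j <= size L)%N ->
  height (take (mp L) L) < height (take j L).
Proof.
move=> /andP[mj jL]; rewrite lt_neqAle height_take_mp // andbT.
apply/eqP => e; suff /mp_max : is_min_point L j by rewrite leqNgt mj.
by apply/is_min_pointP; split=> // i iL; rewrite -e height_take_mp.
Qed.

Definition positive_word W : Prop :=
  forall j, (0 < j <= size W)%N -> 0 < height (take j W).

(** Seen from the seam, the prefixes of [L1 ++ L2] inside [L1] lie at heights
    opposite to those of the suffixes of [L1]. *)
Lemma mp_cat L1 L2 : (forall j, height (drop j L1) <= 0) ->
  positive_word L2 -> mp (L1 ++ L2) = size L1.
Proof.
move=> L1neg L2pos.
have beyond j : (size L1 < j <= size (L1 ++ L2))%N ->
    height L1 < height (take j (L1 ++ L2)).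
  rewrite size_cat take_cat => /andP[lj jle].
  by rewrite ltnNge (ltnW lj) /= height_cat ltrDl L2pos //; lia.
have L1min : is_min_point (L1 ++ L2) (size L1).
  apply/is_min_pointP; rewrite size_cat leq_addr; split=> // j jle.
  rewrite take_size_cat //; case: (ltnP (size L1) j) => [lj|jl].
    by apply/ltW/beyond; rewrite lj size_cat.
  rewrite takel_cat // -{1}(cat_take_drop j L1) height_cat.
  by rewrite gerDl L1neg.
apply/eqP; rewrite eqn_leq mp_max // andbT leqNgt; apply/negP => lt_mp.
have sL1 : (size L1 <= size (L1 ++ L2))%N by rewrite size_cat leq_addr.
have := height_take_mp sL1; rewrite (take_size_cat _ (erefl (size L1))).
by rewrite leNgt beyond // lt_mp mp_le_size.
Qed.

(** A prefix of the rotated word that stays in the second factor lies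
    above the minimum because the minimum is the rightmost one; a longer one is
    what remains of the total height 1 after removing a piece of [L] that
    descends to the minimum. *)
Lemma rot_mp_positive L : height L = 1 -> positive_word (rot (mp L) L).
Proof.
move=> hL j; rewrite size_rot /rot => /andP[j0 jL].
have rL := mp_le_size L.
rewrite take_cat size_drop; case: ltnP => [jr|rj].
  have := @height_take_mp_lt L (mp L + j).
  by rewrite takeD height_cat ltrDl; apply; lia.
set i := (j - _)%N; have ir : (i <= mp L)%N by rewrite /i; lia.
have := height_take_mp (leq_trans ir rL).
rewrite height_cat take_takel // => le_h; move: hL.
rewrite -[L in height L](cat_take_drop (mp L) L) height_cat; lia.
Qed.

Lemma mp_rotate W r : height W = 1 -> positive_word W -> (0 < r)%N ->
  mp (drop r W ++ take r W) = size (drop r W).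
Proof.
move=> hW Wpos r0; apply: mp_cat => j.
  rewrite drop_drop; have [jW|/ltnW Wj] := leqP (j + r) (size W); last first.
    by rewrite drop_oversize // /height big_nil.
  have := Wpos (j + r)%N; move: hW.
  by rewrite -{1}(cat_take_drop (j + r) W) height_cat; lia.
rewrite size_take_min => /andP[j0 jr].
by rewrite take_takel ?Wpos //; lia.
Qed.

Lemma mp_lt_size L : height L = 1 -> (mp L < size L)%N.
Proof.
move=> hL; rewrite ltn_neqAle mp_le_size andbT; apply/eqP => e.
have := height_take_mp (leq0n (size L)).
by rewrite e take_size take0 hL /height big_nil.
Qed.

End Height.

Lemma last_step_cat (L1 L2 : seq step) :
  L2 != [::] -> last_step (L1 ++ L2) = last_step L2.
Proof. by rewrite /last_step last_cat; case: L2. Qed.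

Lemma last_step_mem (L : seq step) : L != [::] -> last_step L \in L.
Proof. by case: L => // s L _; rewrite /last_step /= mem_last. Qed.

(** * Cuts of a word and the bijection *)

Section CycleLemma.
Variables (R : realType) (S : {fset step}) (w l : step -> R).
Hypothesis up_S : up_step \in S.
Hypothesis climb_le1 : forall s : step, s \in S -> s.2 <= 1.
Hypothesis climb_up : forall s : step, s \in S -> s.2 = 1 -> s = up_step.
Hypothesis w_up : w up_step = 1.
Hypothesis l_up : l up_step = 1.
Hypothesis l_nat : forall s : step, s \in S -> l s \is a Num.nat.
Implicit Types (L W N : seq step).

Lemma path_length_cat L1 L2 :
  path_length l (L1 ++ L2) = path_length l L1 + path_length l L2.
Proof. exact: big_cat. Qed.

Lemma path_length_nat L : {subset L <= S} -> path_length l L \is a Num.nat.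
Proof.
by move=> LS; rewrite /path_length big_seq rpred_sum // => s /LS /l_nat.
Qed.

Lemma path_length_drop_le W r r' : {subset W <= S} -> (r <= r')%N ->
  path_length l (drop r' W) <= path_length l (drop r W).
Proof.
move=> WS rr'; rewrite -(cat_take_drop (r' - r) (drop r W)) drop_drop subnK //.
rewrite path_length_cat lerDr natr_ge0 // path_length_nat // => s sW.
by apply: WS; apply: mem_drop (mem_take sW).
Qed.

Lemma positive_word_up W : {subset W <= S} -> height W = 1 ->
  positive_word W -> W = up_step :: behead W.
Proof.
case: W => [_|s N WS _ Wpos]; first by rewrite /height big_nil.
have := Wpos 1%N isT; rewrite /= take0 height_cons /height big_nil addr0 => s0.
have sS := WS s (mem_head _ _); have := climb_le1 sS => s1.
by congr cons; apply: climb_up => //; lia.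
Qed.

Lemma nonneg_pathE N : is_nonneg_path S N <->
  [/\ {subset up_step :: N <= S}, height (up_step :: N) = 1
    & positive_word (up_step :: N)].
Proof.
rewrite /is_nonneg_path is_pathE height_cons.
split=> [[[NS hN] N0]|[NS hN Npos]].
  split; [|by rewrite hN addr0|].
    by move=> s; rewrite inE => /predU1P[->//|/NS].
  move=> [//|j] jN; rewrite /= height_cons.
  by have := N0 j jN; rewrite point_height /=; lia.
split; first split.
- by move=> s sN; apply: NS; rewrite inE sN orbT.
- by rewrite /= in hN; lia.
move=> j jN; have := Npos j.+1 jN.
by rewrite point_height /= height_cons /=; lia.
Qed.

(** The cut [r] of [W] serves the value [m]: some pointed length [j] below the
    length of the [r]-th step satisfies [m = path_length l (drop r W) + j]. *)
Definition cut_at W (m r : nat) : Prop :=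
  (0 < r <= size W)%N /\
  path_length l (drop r W) <= m%:R < path_length l (drop r.-1 W).

(** For [r < r'], the interval of values served by [r'] lies entirely below the
    one served by [r], since the length of [drop r W] never grows with [r]. *)
Lemma cut_unique W m r r' : {subset W <= S} ->
  cut_at W m r -> cut_at W m r' -> r = r'.
Proof.
move=> WS; wlog rr' : r r' / (r <= r')%N.
  by move=> H cr cr'; case: (leqP r r') => [/H|/ltnW/H H']; [|apply/esym]; auto.
move=> [_ /andP[le_m _]] [/andP[r'0 _] /andP[_ m_lt]].
apply/eqP; rewrite eqn_leq rr' leqNgt; apply/negP => lt_rr'.
have : (r <= r'.-1)%N by lia.
move=> /(path_length_drop_le WS) /(lt_le_trans m_lt) /lt_le_trans /(_ le_m).
by rewrite ltxx.
Qed.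

(** The least [r] for which [drop r W] is no longer than [m] serves [m]. *)
Lemma cut_exists W m : m%:R < path_length l W -> exists r, cut_at W m r.
Proof.
move=> m_lt.
have ex : exists r, path_length l (drop r W) <= m%:R.
  by exists (size W); rewrite drop_size /path_length big_nil ler0n.
have [r le_m rmin] := ex_minnP ex; exists r.
have r0 : (0 < r)%N.
  by case: r le_m {rmin} => //; rewrite drop0 leNgt m_lt.
split; [rewrite r0 /=|rewrite le_m /=].
  by apply: rmin; rewrite drop_size /path_length big_nil ler0n.
by rewrite ltNge; apply/negP => /rmin; lia.
Qed.

Lemma path_length_drop_pred W r : (0 < r <= size W)%N ->
  path_length l (drop r.-1 W) =
  l (last_step (take r W)) + path_length l (drop r W).
Proof.
case: r => // r /= rW; rewrite (drop_nth (0, 0)) // (take_nth (0, 0)) //.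
by rewrite /last_step last_rcons /path_length big_cons.
Qed.

Definition word_of (P : pointed_path) : seq step := rot (mp P.1) P.1.

(** The number of steps after the rightmost minimum, which is where the seam
    of the original path falls in [word_of P]. *)
Definition cut_of (P : pointed_path) : nat := (size P.1 - mp P.1)%N.

Lemma word_ofK (P : pointed_path) :
  drop (cut_of P) (word_of P) ++ take (cut_of P) (word_of P) = P.1.
Proof.
rewrite /cut_of /word_of /rot -size_drop drop_size_cat // take_size_cat //.
exact: cat_take_drop.
Qed.

Lemma word_of_perm (P : pointed_path) : perm_eq (word_of P) P.1.
Proof. by rewrite perm_rot. Qed.

Section Pointed.
Variables (n m : nat) (P : pointed_path).
Hypothesis P_in : pointed_set S l n m P.

Lemma pointed_word :
  [/\ {subset word_of P <= S}, height (word_of P) = 1,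
      positive_word (word_of P) & path_length l (word_of P) = n.+1%:R].
Proof.
have [[_ /is_pathE[LS hL] _ _] [lL _ _]] := P_in.
split.
- by move=> s; rewrite (perm_mem (word_of_perm P)) => /LS.
- by rewrite -hL /height (perm_big _ (word_of_perm P)).
- exact: rot_mp_positive.
- by rewrite -lL /path_length (perm_big _ (word_of_perm P)).
Qed.

Lemma pointed_cut : cut_at (word_of P) m (cut_of P) /\
  m%:R = path_length l (drop (cut_of P) (word_of P)) + P.2%:R.
Proof.
have [[_ /is_pathE[LS hL] _ jl] [_ mlpP _]] := P_in.
have mpP := mp_lt_size hL; have wK := word_ofK P.
have cut_bounds : (0 < cut_of P <= size (word_of P))%N.
  by rewrite /cut_of /word_of size_rot; lia.
have dropE : drop (cut_of P) (word_of P) = take (mp P.1) P.1.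
  by rewrite /cut_of /word_of /rot -size_drop drop_size_cat.
have mE : m%:R = path_length l (drop (cut_of P) (word_of P)) + P.2%:R.
  by rewrite dropE -mlpP.
split=> //; split=> //.
have lastE : last_step (take (cut_of P) (word_of P)) = last_step P.1.
  have [c0 c_le] := andP cut_bounds.
  by rewrite -wK last_step_cat // -size_eq0 -lt0n size_takel.
rewrite path_length_drop_pred // lastE mE.
have := ler0n R P.2; move: jl.
by set x := path_length _ _; set y := l _; set z := P.2%:R; lra.
Qed.

End Pointed.

(** The pointed length is the excess of [m] over the length of [drop r W]; the
    upper bound in [cut_at] keeps it below the length of the last step, and this
    is also what forces that step to have length at least 1. *)
Lemma pointed_of_cut n m r W : {subset W <= S} -> height W = 1 ->
  positive_word W -> path_length l W = n.+1%:R -> cut_at W m r ->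
  exists2 P, pointed_set S l n m P & word_of P = W.
Proof.
move=> WS hW Wpos lW [rW /andP[le_m m_lt]].
have /andP[r0 r_le] := rW.
have takeN0 : take r W != [::] by rewrite -size_eq0 -lt0n size_takel.
have drop_nat : path_length l (drop r W) \is a Num.nat.
  by apply: path_length_nat => s /mem_drop /WS.
have [d dE] := natrP drop_nat.
have lastS : last_step (take r W) \in S.
  exact/WS/(@mem_take r)/last_step_mem.
have [q qE] := natrP (l_nat lastS).
move: m_lt le_m; rewrite (path_length_drop_pred rW) dE qE -natrD ltr_nat ler_nat.
move=> m_lt le_m.
set L := drop r W ++ take r W.
have LW : perm_eq L W by rewrite /L perm_catC cat_take_drop.
have mpL : mp L = size (drop r W) by exact: mp_rotate.
have lastL : last_step L = last_step (take r W).
  by rewrite last_step_cat.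
have last1 : 1 <= l (last_step L) by rewrite lastL qE ler1n; lia.
exists (L, (m - d)%N); last first.
  by rewrite /word_of /= mpL rot_size_cat cat_take_drop.
split; split=> //=.
- by apply/eqP => L0; move: LW; rewrite L0 perm_sym => /perm_nilP W0;
    move: rW; rewrite W0 /=; lia.
- apply/is_pathE; split; last by rewrite -hW /height (perm_big _ LW).
  by move=> s; rewrite (perm_mem LW) => /WS.
- by rewrite lerBrDr natr1 lastL qE ler_nat; lia.
- by rewrite -lW /path_length (perm_big _ LW).
- by rewrite /mlp /ml /= mpL take_size_cat // dE -natrD subnKC.
Qed.

(** The up step in front of [word_of P] has length 1, which accounts for the
    drop from [n.+1] to [n]. *)
Lemma pointed_nonneg_bij n m : (m <= n)%N ->
  set_bij (pointed_set S l n m) (nonneg_set S l n) (behead \o word_of).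
Proof.
move=> mn; split.
- move=> P /pointed_word[WS hW Wpos lW]; have WE := positive_word_up WS hW Wpos.
  split; first by apply/nonneg_pathE; rewrite /= -WE.
  move: lW; rewrite WE /path_length big_cons l_up -natr1 addrC.
  by move=> /addIr.
- move=> P Q; rewrite !inE => Pin Qin /= eqW.
  have [WS hW Wpos _] := pointed_word Pin.
  have [WS' hW' Wpos' _] := pointed_word Qin.
  have wPQ : word_of P = word_of Q.
    by rewrite (positive_word_up WS hW) // (positive_word_up WS' hW') // eqW.
  have [cP mP] := pointed_cut Pin; have [cQ mQ] := pointed_cut Qin.
  have cPQ : cut_of P = cut_of Q by apply: cut_unique cP _ => //; rewrite wPQ.
  rewrite (surjective_pairing P) (surjective_pairing Q).
  congr pair; first by rewrite -word_ofK wPQ cPQ word_ofK.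
  by apply/eqP; move: mP; rewrite mQ wPQ cPQ => /addrI /eqP; rewrite eqr_nat eq_sym.
- move=> N [/nonneg_pathE[WS hW Wpos] lN].
  have lW : path_length l (up_step :: N) = n.+1%:R.
    by rewrite -natr1 -lN /path_length big_cons l_up addrC.
  have [r cr] : exists r, cut_at (up_step :: N) m r.
    by apply: cut_exists; rewrite lW ltr_nat ltnS.
  have [P Pin PW] := pointed_of_cut WS hW Wpos lW cr.
  by exists P => //=; rewrite PW.
Qed.

Lemma gbar_sum_eq_f_sum n m : (m <= n)%N -> gbar_sum S w l n m = f_sum S w l n.
Proof.
move=> mn; rewrite /f_sum (reindex_fsbig _ _ _ _ (pointed_nonneg_bij mn)).
apply: eq_fsbigr => P; rewrite inE => Pin /=.
have [WS hW Wpos _] := pointed_word Pin.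
rewrite /path_weight -(perm_big _ (word_of_perm P)) /=.
by rewrite {1}(positive_word_up WS hW Wpos) big_cons w_up mul1r.
Qed.

End CycleLemma.

(** * The two classes of steps *)

Lemma steps_climb c (A B : {fset nat}) s : s \in steps c A B ->
  s.2 <= 1 /\ (s.2 = 1 -> s = up_step).
Proof.
rewrite !in_fsetE => /orP[/orP[]|/eqP->//].
  by move=> /imfsetP[i _ ->]; case: c.
by move=> /imfsetP[i _ ->]; case: c.
Qed.

Lemma step_length_nat (R : realType) c (A B : {fset nat}) s :
  (forall i, i \in A -> (0 < i)%N) -> s \in steps c A B ->
  step_length R c s \is a Num.nat.
Proof.
move=> A0; rewrite !in_fsetE => /orP[/orP[]|/eqP->].
- move=> /imfsetP[i /= /A0 i0 ->]; case: c.
    by rewrite step_length_down1 // -(prednK i0) -natr1 addrK natr_nat.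
  by rewrite step_length_down2 natr_nat.
- by move=> /imfsetP[i _ ->]; rewrite step_length_level natr_nat.
- by rewrite step_length_up rpred1.
Qed.

Theorem theorem4p3 (R : realType) (A B : {fset nat})
    (A_pos : forall i : nat, i \in A -> (0 < i)%N)
    (B_pos : forall i : nat, i \in B -> (0 < i)%N)
    (a b : nat -> R) (c : step_class) (n m : nat) (m_le_n : (m <= n)%N) :
  gbar_sum (steps c A B) (step_weight c a b) (@step_length R c) n m =
  f_sum (steps c A B) (step_weight c a b) (@step_length R c) n.
Proof.
apply: gbar_sum_eq_f_sum m_le_n.
- by rewrite !in_fsetE eqxx orbT.
- by move=> s /steps_climb[].
- by move=> s /steps_climb[].
- exact: step_weight_up.
- exact: step_length_up.
- by move=> s; exact: step_length_nat.
Qed.
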